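(* $\mathrm{cov}(\mathcal{M}_-)=\mathrm{cov}(\mathcal{M})$ and $\mathrm{non}(\mathcal{M}_-)=\mathrm{non}(\mathcal{M})$.
   Context: $\mathcal{M}$ is the $\sigma$-ideal of meager subsets of $\omega^\omega$. $\forall^\infty n$ means ''for all but finitely many $n\in\omega$''. A set $F\subseteq\omega^\omega$ belongs to $\mathcal{M}_-$ if there are $x_F\in\omega^\omega$ and a partition $(I_n)_{n\in\omega}$ of $\omega$ into (nonempty, finite) intervals such that $F\subseteq\{x\in\omega^\omega:(\forall^\infty n)(x\upharpoonright I_n\neq x_F\upharpoonright I_n)\}$; $\mathcal{M}_-$ is known to be a $\sigma$-ideal. For a $\sigma$-ideal $\mathcal{I}$ on $\omega^\omega$, $\mathrm{cov}(\mathcal{I})=\min\{|\mathcal{A}|:\mathcal{A}\subseteq\mathcal{I}\wedge\bigcup\mathcal{A}=\omega^\omega\}$ and $\mathrm{non}(\mathcal{I})=\min\{|A|:A\subseteq\omega^\omega\wedge A\notin\mathcal{I}\}$. *)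

(* Defs.v *)
(* MathComp-Analysis *)
From mathcomp Require Import all_boot all_order.
From mathcomp Require Import boolp classical_sets functions cardinality.
From mathcomp Require Import topology.

Set Implicit Arguments.
Unset Strict Implicit.
Unset Printing Implicit Defensive.

Local Open Scope classical_set_scope.
Local Open Scope card_scope.

(* [nat] carries the discrete topology, so this is the Baire space. *)
Definition baire := {ptws nat -> nat}.

Definition nowhere_dense (T : topologicalType) (A : set T) : Prop :=
  interior (closure A) = set0.

Definition meager (T : topologicalType) : set (set T) :=
  [set A | exists2 N : nat -> set T,
     (forall i, nowhere_dense (N i)) & A `<=` \bigcup_i N i].

(* [partition] makes every block nonempty. The blocks need not be enumerated
   in increasing order. *)
Definition interval_partition (I : nat -> set nat) : Prop :=
  partition [set: nat] I [set: nat] /\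
  forall n, exists a b, I n = [set k | (a <= k < b)%N].

Definition meager_minus : set (set baire) :=
  [set F | exists xF : baire, exists2 I : nat -> set nat,
     interval_partition I &
     F `<=` [set x : baire |
       \forall n \near \oo, ~ (forall k, I n k -> x k = xF k)]].

(* Cardinals are represented by sets up to equipotence [#=]: the cardinality
   of [K] is the minimum (in particular, it is attained) of the cardinalities
   of the members of [C]. *)
Definition is_min_card (T U : Type) (C : set (set T)) (K : set U) : Prop :=
  (exists2 A, C A & K #= A) /\ forall A, C A -> K #<= A.

Definition is_cov (T U : Type) (I : set (set T)) (K : set U) : Prop :=
  is_min_card [set A : set (set T) | A `<=` I /\ \bigcup_(F in A) F = setT] K.

Definition is_non (T U : Type) (I : set (set T)) (K : set U) : Prop :=
  is_min_card [set A : set T | ~ I A] K.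

(* Main.v *)
Require Import Defs.
From mathcomp Require Import all_boot all_order.
From mathcomp Require Import boolp classical_sets functions cardinality.
From mathcomp Require Import topology.
From mathcomp Require Import zify.

Set Implicit Arguments.
Unset Strict Implicit.
Unset Printing Implicit Defensive.

Local Open Scope classical_set_scope.
Local Open Scope card_scope.

(** Write M for the meager ideal and M_- for [meager_minus]. Every set of M_-
    is meager: to enter a set of points that miss [xF] on all late blocks is
    to commit to never copying [xF] on a late block, and every finite sequence
    can be extended so as to copy one ([meager_minus_meager]). This gives
    cov(M) <= cov(M_-) and non(M_-) <= non(M).

    The converse inequalities are a form of Bartoszynski's theorem that two
    infinitely-often-equal reals added in succession yield a Cohen real. It is
    isolated in [two_step]: there is a fixed map [guess] such that, for every
    meager M, all g outside some E in M_- have the property that, for all h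
    outside some E' in M_- (depending on g), [guess g h] lies outside M.

    To see why this holds, recall that a meager set M is avoided by a branch of
    the tree of finite sequences as soon as the branch follows infinitely often
    a certain function [phi] from sequences to longer sequences
    ([meager_extension]). One would like h to guess [phi] infinitely often,
    but a natural number cannot code all of [phi]. The first real g supplies
    an increasing sequence of levels; since g equals infinitely often a fast
    growing function built from [phi], for infinitely many n the values of
    [phi] on all sequences with code below the n-th level have codes below the
    next level ([levels_escape]). Let X be the set of these n. The second real
    h is required to equal, for infinitely many n in X, the code of the finite
    table of [phi] below the n-th level. A branch that stays below the levels
    and applies the tables proposed by h whenever it can then follows [phi]
    infinitely often. Missing a prescribed function on almost all of an
    infinite set X only describes a set of M_-, because the interval partition
    may be chosen so that each block meets X ([meager_minus_missing]).

    For cov, apply this to a cover by meager sets M: either the sets E cover,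
    or some g lies outside all of them, and then the sets E' for this g cover.
    For non, if A is not in M_- then [guess] maps A x A onto a nonmeager set,
    whose cardinality is at most that of A because A is infinite. The latter
    needs |A x A| <= |A|, and the existence of the minimal cardinals needs
    cardinals to be well ordered; both are consequences of Zorn's lemma. *)

(** * Consequences of the axiom of choice for cardinals *)

Lemma card_le_of_inj (T U : Type) (A : set T) (B : set U) (f : T -> U) :
  (forall x, A x -> B (f x)) ->
  (forall x y, A x -> A y -> f x = f y -> x = y) -> A #<= B.
Proof.
move=> fAB fI; rewrite -(card_le_eql (inj_card_eq (f := f) _)).
  by apply: subset_card_le => _ [x Ax <-]; exact: fAB.
by move=> x y; rewrite !inE; exact: fI.
Qed.

Lemma inj_of_card_le (T : Type) (U : pointedType) (A : set T) (B : set U) :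
  A #<= B -> exists f : T -> U, (forall x, A x -> B (f x)) /\
    (forall x y, A x -> A y -> f x = f y -> x = y).
Proof.
move=> /pcard_leP[f]; exists f; split=> [x Ax|x y Ax Ay]; first exact: funS.
by apply: inj; rewrite inE.
Qed.

(** Take a maximal set [S] of choice functions for [C] that pairwise differ at
    every member of [C]. If for every member some point were not the value of
    a function in [S], these points would form a new choice function. So the
    values of [S] exhaust some member of [C], which therefore injects into [S],
    and [S] injects into every member of [C] by evaluation. *)
Lemma min_card_exists (T : Type) (C : set (set T)) :
  C !=set0 -> exists2 A, C A & forall B, C B -> A #<= B.
Proof.
move=> [B0 CB0].
have [/eqP B00|/set0P[t0 _]] := boolP (B0 == set0).
  by exists B0 => // B _; rewrite B00 card_ge0.
pose P (S : set (set T -> T)) :=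
  (forall f B, S f -> C B -> B (f B)) /\
  (forall f g B, S f -> S g -> C B -> f B = g B -> f = g).
have [F FP Ftot|S [[Sin Sinj] Smax]] := @Zorn_bigcup _ P.
  split=> [f B [S FS Sf] CB|f g B [S FS Sf] [S' FS' S'g] CB].
    by have [FS1 _] := FP _ FS; exact: FS1 _ _ Sf CB.
  have [SS'|S'S] := Ftot _ _ FS FS'.
    by have [_ FS2] := FP _ FS'; exact: FS2 _ _ _ (SS' _ Sf) S'g CB.
  by have [_ FS2] := FP _ FS; exact: FS2 _ _ _ Sf (S'S _ S'g) CB.
have [[A [CA AS]]|noA] :=
    pselect (exists A, C A /\ A `<=` [set f A | f in S]).
  exists A => // B CB; apply: (card_le_trans (subset_card_le AS)).
  apply: (card_le_trans (card_image_le _ _)).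
  apply: (@card_le_of_inj _ _ _ _ (@^~ B)) => [f Sf|f g Sf Sg].
    exact: Sin _ _ Sf CB.
  exact: Sinj _ _ _ Sf Sg CB.
have /choice[h hP] B : exists b, C B -> B b /\ ~ [set f B | f in S] b.
  have [CB|] := pselect (C B); last by exists t0.
  apply: contrapT => nb; apply: noA; exists B; split=> // b Bb.
  by apply: contrapT => Sb; apply: nb; exists b.
have [_ hS] := hP _ CB0.
case: (Smax (h |` S)).
  split; first exact: subsetUr.
  by move=> /(_ h (or_introl erefl)) Sh; apply: hS; exists h.
split=> [f B [->|Sf] CB|f g B [->|Sf] [->|Sg] CB //].
- by have [] := hP _ CB.
- exact: Sin _ _ Sf CB.
- by move=> hg; case: (hP _ CB) => _ []; exists g.
- by move=> hg; case: (hP _ CB) => _ []; exists f.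
- exact: Sinj _ _ _ Sf Sg CB.
Qed.

Lemma card_le_total (T : Type) (A B : set T) : A #<= B \/ B #<= A.
Proof.
have [|C [->|->] CP] := @min_card_exists T [set A; B]; first by exists A; left.
- by left; apply: CP; right.
- by right; apply: CP; left.
Qed.

(** A relation rather than a function, so that unions of chains need no gluing:
    [G] relates every pair over [D] to elements of [D], possibly several, and
    no element is related to two pairs; choosing one value for each pair gives
    an injection of [D `*` D] into [D]. The set [D] is recovered from [G]. *)
Definition injective_square (T : Type) (A : set T) (G : set ((T * T) * T)) :=
  let D := [set x | exists z, G (x, x, z)] in
  [/\ forall x y z, G (x, y, z) -> [/\ D x, D y & D z], D `<=` A,
      forall x y, D x -> D y -> exists z, G (x, y, z) &
      forall p q z, G (p, z) -> G (q, z) -> p = q].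

(** By Zorn's lemma there is a maximal injective square [H] containing one whose
    domain is countably infinite; let [D] be its domain. Doubling fits into
    [D], because [D] has two points [N 0] and [N 1] that can serve as tags. If
    [A `\` D] injects into [D], so does [A], hence so does [A `*` A]. Otherwise
    [A `\` D] contains a copy of [D] disjoint from [D], and sending the pairs
    over the union of [D] and this copy into the copy extends [H]. *)
Lemma card_square_le (T : pointedType) (A : set T) :
  infinite_set A -> A `*` A #<= A.
Proof.
move=> /infiniteP /inj_of_card_le[N [NA Ninj]].
pose G0 : set ((T * T) * T) := [set u | exists i j,
  u = (N i, N j, N (pickle (i, j)))].
have NI i j : N i = N j -> i = j by exact: Ninj.
have G0P : injective_square A G0.
  have DN i : exists z, G0 (N i, N i, z) by exists (N (pickle (i, i))), i, i.
  split=> [x y z [i [j [-> -> ->]]]//|x [_ [i [_ [-> _ _]]]]||].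
  - by split; exact: DN.
  - exact: NA.
  - move=> x y [_ [i [_ [-> _ _]]]] [_ [j [_ [-> _ _]]]].
    by exists (N (pickle (i, j))), i, j.
  - move=> p q z [i [j [-> ->]]] [i' [j' [-> /NI]]].
    by move=> /(pcan_inj pickleK)[-> ->].
(* Joining [G0] to each member of a chain ensures that the maximal square
   contains [G0], and covers the empty chain as well. *)
pose P G := injective_square A (G `|` G0).
have [F FP Ftot|G [GP Gmax]] := @Zorn_bigcup _ P.
  have big u v : (\bigcup_(X in F) X `|` G0) u ->
      (\bigcup_(X in F) X `|` G0) v -> exists G, [/\ G u, G v,
        injective_square A G & G `<=` \bigcup_(X in F) X `|` G0].
    have sub X : F X -> X `|` G0 `<=` \bigcup_(X in F) X `|` G0.
      by move=> FX w [Xw|?]; [left; exists X|right].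
    move=> [[X FX Xu]|G0u] [[Y FY Yv]|G0v].
    - have [XY|YX] := Ftot _ _ FX FY.
        exists (Y `|` G0); split;
          [left; exact: XY|by left|exact: FP|exact: sub].
      exists (X `|` G0); split; [by left|left; exact: YX|exact: FP|exact: sub].
    - exists (X `|` G0); split; [by left|by right|exact: FP|exact: sub].
    - exists (Y `|` G0); split; [by right|by left|exact: FP|exact: sub].
    - by exists G0; split=> // w; right.
  split.
  - move=> x y z Gu; have [G [+ _ [G1 _ _ _] Gs]] := big _ _ Gu Gu.
    by move=> /G1[[a /Gs ?] [b /Gs ?] [c /Gs ?]]; split; eexists; eassumption.
  - move=> x [z Gu]; have [G [Gx _ [_ G2 _ _] _]] := big _ _ Gu Gu.
    by apply: G2; exists z.
  - move=> x y [a Gx] [b Gy]; have [G [Gx' Gy' [_ _ G3 _] Gs]] := big _ _ Gx Gy.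
    have [||z /Gs Gz] := G3 x y; [by exists a|by exists b|by exists z].
  - move=> p q z Gp Gq; have [G [Gp' Gq' [_ _ _ G4] Gs]] := big _ _ Gp Gq.
    exact: G4 Gp' Gq'.
move: GP; rewrite /P; set H := G `|` G0; case.
set D := [set x | _] => H1 DA H3 H4.
have DN i : D (N i) by exists (N (pickle (i, i))); right; exists i, i.
have /choice[g gP] (p : T * T) : exists z, D p.1 -> D p.2 -> H (p, z).
  have [[Dx Dy]|nD] := pselect (D p.1 /\ D p.2).
    by have [z Hz] := H3 _ _ Dx Dy; exists z; case: p Hz {Dx Dy}.
  by exists point => Dx Dy; case: nD.
have gD x y : D x -> D y -> D (g (x, y)).
  by move=> Dx Dy; have /H1[] := gP (x, y) Dx Dy.
have gI x y x' y' : D x -> D y -> D x' -> D y' ->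
    g (x, y) = g (x', y') -> x = x' /\ y = y'.
  move=> Dx Dy Dx' Dy' E; have := gP (x', y') Dx' Dy'; rewrite -E.
  by move=> /(H4 _ _ _ (gP (x, y) Dx Dy))[-> ->].
have dbl (E : set T) : (forall x, E x -> ~ D x) -> E #<= D ->
    exists e : T -> T, (forall x, (D `|` E) x -> D (e x)) /\
      (forall x y, (D `|` E) x -> (D `|` E) y -> e x = e y -> x = y).
  move=> ED /inj_of_card_le[j [jD jI]].
  pose e x := if `[< D x >] then g (N 0, x) else g (N 1, j x).
  have eD x : D x -> e x = g (N 0, x) by move=> Dx; rewrite /e asboolT.
  have eE x : E x -> e x = g (N 1, j x).
    by move=> Ex; rewrite /e asboolF//; exact: ED.
  exists e; split=> [x [Dx|Ex]|x y [Dx|Ex] [Dy|Ey]].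
  - by rewrite eD//; exact: gD.
  - by rewrite eE//; apply: gD => //; exact: jD.
  - by rewrite !eD// => /(gI _ _ _ _ (DN 0) Dx (DN 0) Dy)[].
  - by rewrite eD// eE// => /(gI _ _ _ _ (DN 0) Dx (DN 1) (jD _ Ey))[/NI].
  - by rewrite eE// eD// => /(gI _ _ _ _ (DN 1) (jD _ Ex) (DN 0) Dy)[/NI].
  - rewrite !eE// => /(gI _ _ _ _ (DN 1) (jD _ Ex) (DN 1) (jD _ Ey))[_].
    exact: jI.
have [AD|DA'] := card_le_total (A `\` D) D.
  have [|e [eD eI]] := dbl _ _ AD; first by move=> x [].
  have {}AD x : A x -> (D `|` (A `\` D)) x.
    by move=> Ax; have [Dx|nDx] := pselect (D x); [left|right].
  apply: (@card_le_of_inj _ _ _ _ (fun p => g (e p.1, e p.2))).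
    by move=> [x y] [/= /AD Ax /AD Ay]; apply/DA/gD; exact: eD.
  move=> [x y] [x' y'] [/= /AD Ax /AD Ay] [/= /AD Ax' /AD Ay'].
  by case/gI; try exact: eD; move=> /eI -> // /eI ->.
have [i [iA iI]] := inj_of_card_le DA'.
have [||e [eD eI]] := dbl (i @` D).
- by move=> _ [x Dx <-]; have [] := iA _ Dx.
- exact: card_image_le.
pose D' := D `|` i @` D.
pose H' : set ((T * T) * T) := H `|` [set u | exists x y,
  [/\ D' x, D' y & u = (x, y, i (g (e x, e y)))]].
have D'E : [set x | exists z, H' (x, x, z)] = D'.
  apply/seteqP; split=> [x [z [Hz|[a [b [Da _ [-> _ _]]]]]]//|x D'x].
    by left; exists z.
  by exists (i (g (e x, e x))); right; exists x, x.
have gei x y : D' x -> D' y -> D (g (e x, e y)).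
  by move=> ? ?; apply: gD; exact: eD.
case: (Gmax H').
  split; first by move=> u Gu; left; left.
  move=> sub.
  have iN : D' (i (N 0)) by right; exists (N 0).
  have [] := iA _ (DN 0); move=> _; apply.
  have : H' (i (N 0), i (N 0), i (g (e (i (N 0)), e (i (N 0))))).
    by right; exists (i (N 0)), (i (N 0)).
  by move=> /sub Hu; exists (i (g (e (i (N 0)), e (i (N 0))))); left.
rewrite /P; have -> : H' `|` G0 = H'.
  by apply/seteqP; split=> [u [//|G0u]|u]; left => //; right.
rewrite /injective_square D'E; split.
- move=> x y z [/H1[? ? ?]|[a [b [Da Db [-> -> ->]]]]]; first by split; left.
  by split=> //; right; exists (g (e a, e b)) => //; exact: gei.
- by move=> x [/DA//|[y Dy <-]]; have [] := iA _ Dy.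
- by move=> x y D'x D'y; exists (i (g (e x, e y))); right; exists x, y.
- move=> p q z [Hp|[a [b [Da Db [-> ->]]]]] [Hq|[a' [b' [Da' Db' [-> E]]]]].
  + exact: H4 Hp Hq.
  + case: p Hp => x y /H1[_ _ Dz]; rewrite E in Dz.
    by have [] := iA _ (gei _ _ Da' Db').
  + case: q Hq => x y /H1[_ _ Dz].
    by have [] := iA _ (gei _ _ Da Db).
  + have [/eI -> // /eI -> //] := gI _ _ _ _ (eD _ Da) (eD _ Db) (eD _ Da')
      (eD _ Db') (iI _ _ (gei _ _ Da Db) (gei _ _ Da' Db') E).
Qed.

(** * Baire category in terms of finite sequences *)

Definition cylinder (s : seq nat) : set baire :=
  [set x | forall k, (k < size s)%N -> x k = nth 0 s k].

Lemma cylinder_mkseq (x y : baire) n :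
  cylinder (mkseq x n) y <-> forall k, (k < n)%N -> y k = x k.
Proof.
rewrite /cylinder /= size_mkseq.
by split=> xy k kn; move: (xy k kn); rewrite nth_mkseq.
Qed.

Lemma cylinderS s t : prefix s t -> cylinder t `<=` cylinder s.
Proof.
move=> /prefixP[r ->] x xt k ks; rewrite xt ?nth_cat ?ks//.
by rewrite size_cat ltn_addr.
Qed.

(** The topology is that of pointwise convergence, and the filter generated by
    the cylinders around [x] converges pointwise to [x] because each coordinate
    is eventually constant along it. *)
Lemma nbhs_cylinder (x : baire) (U : set baire) :
  nbhs x U <-> exists n, cylinder (mkseq x n) `<=` U.
Proof.
split=> [|[n]].
- pose F : set_system baire := filter_from setT (fun n => cylinder (mkseq x n)).
  have FF : Filter F.
    apply: filter_from_filter; first by exists 0.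
    move=> m n _ _; exists (maxn m n) => // y /cylinder_mkseq xy.
    by split; apply/cylinder_mkseq => k kn; apply: xy; rewrite leq_max kn ?orbT.
  suff /[apply] : F --> x by move=> -[n _ nU]; exists n.
  apply/(@pointwise_cvgP nat nat) => t A.
  rewrite nbhs_simpl /= => /nbhs_singleton At.
  by exists t.+1 => // y /cylinder_mkseq /(_ t (leqnn _)) /= ->.
- move=> nU; apply: filterS nU _.
  elim: n => [|n IH].
    by apply: filterS filterT => y _; apply/cylinder_mkseq.
  have : nbhs x [set y : baire | y n = x n].
    exact: (@proj_continuous nat (fun=> nat) n x [set x n]).
  apply: filterS2 IH => y /cylinder_mkseq xy yn; apply/cylinder_mkseq => k.
  by rewrite ltnS leq_eqVlt => /predU1P[->//|]; exact: xy.
Qed.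

Lemma prefix_mkseq s (x : baire) n :
  cylinder s x -> (size s <= n)%N -> prefix s (mkseq x n).
Proof.
move=> sx sn; apply/prefixP; exists (drop (size s) (mkseq x n)).
rewrite -{1}(cat_take_drop (size s) (mkseq x n)); congr (_ ++ _).
apply: (@eq_from_nth _ 0) => [|k]; rewrite size_take size_mkseq.
  by case: ltngtP sn.
have -> : (if (size s < n)%N then size s else n) = size s by case: ltngtP sn.
move=> ks; rewrite nth_take// nth_mkseq ?(leq_trans ks)//; exact: sx.
Qed.

Lemma nowhere_denseP (A : set baire) :
  nowhere_dense A <->
  forall s, exists t, prefix s t /\ forall x, cylinder t x -> ~ A x.
Proof.
split=> [nA s|As].
- apply: contrapT => nt.
  have : interior (closure A) (nth 0 s : baire).
    apply/nbhs_cylinder; exists (size s); rewrite mkseq_nth => y sy U.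
    move=> /nbhs_cylinder[n nU]; apply: contrapT => AU; apply: nt.
    exists (mkseq y (maxn n (size s))); split.
      by apply: prefix_mkseq => //; rewrite leq_maxr.
    move=> x /cylinder_mkseq yx Ax; apply: AU; exists x; split=> //.
    by apply/nU/cylinder_mkseq => k kn; apply: yx; rewrite leq_max kn.
  by rewrite nA.
- apply/seteqP; split=> // x /nbhs_cylinder[n nA].
  have [t [st tA]] := As (mkseq x n).
  have /nA : cylinder (mkseq x n) (nth 0 t : baire) by exact: (cylinderS st).
  move=> /(_ (cylinder t))[|y [Ay ty]]; last exact: tA Ay.
  by apply/nbhs_cylinder; exists (size t); rewrite mkseq_nth.
Qed.

(** * Members of [meager_minus] *)

(** Finitely many blocks contain all numbers below [l], and the other blocks
    are disjoint from these. *)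
Lemma interval_partition_tail (I : nat -> set nat) m l :
  interval_partition I -> exists n, (m <= n)%N /\ forall k, I n k -> (l <= k)%N.
Proof.
move=> [[covI trivI _] _].
have /choice[b bP] k : exists n, I n k.
  have : (\bigcup_(n in setT) I n) k by rewrite -/(cover _ _) covI.
  by move=> [n _ ?]; exists n.
exists (m + (\sum_(k < l) b k).+1); split=> [|k Ik]; first exact: leq_addr.
rewrite leqNgt; apply/negP => kl.
have E : b k = m + (\sum_(k < l) b k).+1.
  by apply: trivI => //; exists k.
have : (b k <= \sum_(k < l) b k)%N by rewrite (bigD1 (Ordinal kl))//= leq_addr.
by rewrite E; lia.
Qed.

(** A finite sequence [s] can be prolonged by copying [xF] beyond its length, up
    to the end of a late block that starts after [s]. *)
Lemma meager_minus_meager : meager_minus `<=` @meager baire.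
Proof.
move=> F [xF [I Ipart FI]].
exists (fun m => [set x : baire | forall n, (m <= n)%N ->
    ~ (forall k, I n k -> x k = xF k)]); last first.
  by move=> x /FI [m _ mx]; exists m.
move=> m; apply/nowhere_denseP => s.
have [n [mn sI]] := interval_partition_tail m (size s) Ipart.
have [_ /(_ n)[a [b Inab]]] := Ipart.
pose y : baire := fun k => if (k < size s)%N then nth 0 s k else xF k.
exists (mkseq y (maxn b (size s))); split.
  by apply: prefix_mkseq; rewrite ?leq_maxr// => k ks; rewrite /y ks.
move=> x /cylinder_mkseq yx /(_ n mn); apply=> k Ik.
have /sI sk := Ik; move: Ik; rewrite Inab /= => /andP[_ kb].
by rewrite yx ?leq_max ?kb// /y ltnNge sk.
Qed.

Definition frequently (X : set nat) : Prop :=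
  forall m, exists2 n, (m <= n)%N & X n.

Definition missing (X : set nat) (y : baire) : set baire :=
  [set x | \forall n \near \oo, X n -> x n <> y n].

Lemma not_missing X y x :
  ~ missing X y x -> frequently [set n | X n /\ x n = y n].
Proof.
move=> nm m; apply: contrapT => nX; apply: nm; exists m => // n /= mn Xn xy.
by apply: nX; exists n.
Qed.

(** Cut the natural numbers just after an element of [X], again and again: a
    point that agrees with [y] on a whole block of the resulting partition
    agrees with [y] at an element of [X]. *)
Lemma meager_minus_missing (X : set nat) (y : baire) :
  frequently X -> meager_minus (missing X y).
Proof.
move=> Xinf.
have /choice[e eP] m : exists n, (m <= n)%N /\ X n.
  by have [n mn Xn] := Xinf m; exists n.
pose a n := iter n (fun m => (e m).+1) 0.
have aS n : (a n < a n.+1)%N by have [] := eP (a n).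
have amono : {homo a : m n / (m <= n)%N}.
  by apply: homo_leq => [//|m n p|m]; [exact: leq_trans|exact: ltnW].
pose I n := [set k | (a n <= k < a n.+1)%N].
exists y, I.
  split; last by move=> n; exists (a n), (a n.+1).
  split.
  - apply/seteqP; split=> // k _.
    have nk : exists n, (k < a n)%N.
      exists k.+1; elim: k => [|k IH]; first exact: (aS 0).
      exact: leq_ltn_trans IH (aS _).
    case: (ex_minnP nk) => -[//|n kn nmin]; exists n => //.
    rewrite /I /= kn andbT.
    by rewrite leqNgt; apply/negP => /nmin; rewrite ltnn.
  - move=> m n _ _ [k [/andP[mk km] /andP[nk kn]]].
    case: (ltngtP m n) => // [/amono|/amono] h.
      by have := leq_trans km (leq_trans h nk); rewrite ltnn.
    by have := leq_trans kn (leq_trans h mk); rewrite ltnn.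
  - by move=> n _; exists (a n); rewrite /I /= leqnn aS.
move=> x [m _ mx].
exists m => // n /= mn xy; have [le_e Xe] := eP (a n).
apply: (mx (e (a n))) => //=.
  apply: leq_trans le_e; apply: (leq_trans mn).
  by elim: n {mn xy Xe} => // n IH; apply: leq_ltn_trans IH (aS n).
by apply: xy; rewrite /I /= le_e /=.
Qed.

Lemma meager_minus_missingT (y : baire) : meager_minus (missing setT y).
Proof. by apply: meager_minus_missing => m; exists m. Qed.

(** * Branches that avoid a meager set *)

(** The coordinate [k] is read off any sequence of the chain longer than [k];
    the default 0 is used only if the lengths stay bounded. *)
Definition branch_limit (b : nat -> seq nat) : baire :=
  fun k => nth 0 (b (xget 0 [set n | (k < size (b n))%N])) k.

Lemma branch_limit_cylinder (b : nat -> seq nat) n :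
  (forall n, prefix (b n) (b n.+1)) -> cylinder (b n) (branch_limit b).
Proof.
move=> bS k kn; rewrite /branch_limit; case: xgetP => [m _ /= km|/(_ n)//].
have bmono i j : (i <= j)%N -> prefix (b i) (b j).
  elim: j => [|j IH]; first by rewrite leqn0 => /eqP ->; exact: prefix_refl.
  rewrite leq_eqVlt => /predU1P[->|/IH ij]; first exact: prefix_refl.
  exact: prefix_trans ij (bS j).
by have [/bmono|/ltnW /bmono] := leqP m n; move=> /prefixP[r ->];
  rewrite nth_cat ?km ?kn.
Qed.

(** [phi s] prolongs [s] so as to avoid the first [size s + 1] nowhere dense
    sets covering [M], and is strictly longer than [s]. Infinitely many steps
    along [phi] therefore make the branch infinite, and every nowhere dense set
    is avoided by a late such step. *)
Lemma meager_extension (M : set baire) : meager M ->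
  exists phi : seq nat -> seq nat, (forall s, prefix s (phi s)) /\
    forall b : nat -> seq nat, (forall n, prefix (b n) (b n.+1)) ->
      frequently [set n | b n.+1 = phi (b n)] -> ~ M (branch_limit b).
Proof.
move=> [N Nnd MN].
have avoid s j : exists t, prefix s t /\
    forall i, (i < j)%N -> forall x, cylinder t x -> ~ N i x.
  elim: j => [|j [t [st tN]]]; first by exists s; rewrite prefix_refl.
  have /nowhere_denseP /(_ t)[u [tu uN]] := Nnd j.
  exists u; split=> [|i]; first exact: prefix_trans st tu.
  rewrite ltnS leq_eqVlt => /predU1P[->//|ij] x ux.
  by apply: (tN i ij); exact: (cylinderS tu).
have /choice[psi psiP] s := avoid s (size s).+1.
exists (fun s => rcons (psi s) 0); split=> [s|b bS bf].
  by have [sp _] := psiP s; apply: prefix_trans sp (prefix_rcons _ _).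
have size_hit n :
    b n.+1 = rcons (psi (b n)) 0 -> (size (b n) < size (b n.+1))%N.
  have [/size_prefix sp _] := psiP (b n).
  by move=> ->; rewrite size_rcons ltnS.
have size_mono i j : (i <= j)%N -> (size (b i) <= size (b j))%N.
  elim: j => [|j IH]; first by rewrite leqn0 => /eqP ->.
  rewrite leq_eqVlt => /predU1P[->//|/IH ij].
  exact: leq_trans ij (size_prefix (bS j)).
have size_big j : exists n, (j <= size (b n))%N.
  elim: j => [|j [n jn]]; first by exists 0.
  have [m nm /size_hit bm] := bf n; exists m.+1.
  by apply: leq_ltn_trans bm; exact: leq_trans jn (size_mono _ _ nm).
move=> /MN[i _].
have [n jn] := size_big i; have [m nm bm] := bf n.
have [_ /(_ i)] := psiP (b m).
apply; first by rewrite ltnS (leq_trans jn)// size_mono.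
have := @branch_limit_cylinder b m.+1 bS.
by rewrite bm; apply: cylinderS; exact: prefix_rcons.
Qed.

(** * Two successive guesses *)

Definition levels (g : baire) n := (\sum_(i < n.+1) (g i).+1)%N.

Lemma levels_ltS g n : (levels g n < levels g n.+1)%N.
Proof. by rewrite /levels [in ltnRHS]big_ord_recr /=; lia. Qed.

Lemma levels_gt g n : (g n < levels g n)%N.
Proof. by rewrite /levels big_ord_recr /=; lia. Qed.

(** If each level after the [N]-th were below [F] of its predecessor, the levels
    would be bounded by [n |-> iter (n + c) F 0] for a constant [c]. But they
    exceed [g], which is infinitely often equal to [iter n.*2 F 0], and
    [n + c <= n.*2] for large [n]. *)
Lemma levels_escape (F : nat -> nat) : {homo F : m n / (m <= n)%N} ->
  (forall m, m < F m)%N ->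
  forall g : baire, frequently [set n | g n = iter n.*2 F 0] ->
  frequently [set n | (F (levels g n) <= levels g n.+1)%N].
Proof.
move=> Fmono Finfl g gy N; apply: contrapT => nN.
have slow n : (N <= n)%N -> (levels g n.+1 < F (levels g n))%N.
  by move=> Nn; rewrite ltnNge; apply/negP => h; apply: nN; exists n.
have iter_ge m : (m <= iter m F 0)%N.
  by elim: m => // m IH; exact: leq_ltn_trans (Finfl _).
have iter_mono m n : (m <= n)%N -> (iter m F 0 <= iter n F 0)%N.
  elim: n => [|n IH]; first by rewrite leqn0 => /eqP ->.
  rewrite leq_eqVlt => /predU1P[->//|/IH h].
  exact: leq_trans h (ltnW (Finfl _)).
have bound j : (levels g (N + j) <= iter (j + levels g N) F 0)%N.
  elim: j => [|j IH]; first by rewrite addn0.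
  rewrite addnS; apply: leq_trans (ltnW (slow _ (leq_addr _ _))) _.
  exact: Fmono.
have [n nbig gn] := gy (N + levels g N)%N.
have Nn : (N <= n)%N by lia.
have := bound (n - N)%N; rewrite subnKC// => bn.
have := levels_gt g n; rewrite gn ltnNge => /negP; apply.
by apply: leq_trans bn _; apply: iter_mono; lia.
Qed.

(** [h n] is read as the code of a finite table whose entry at the code of [s]
    is the code of the proposed extension of [s]. The proposal is accepted only
    if it extends [s] and has a code below the next level, so that the tables
    that [h] has to guess can be bounded in advance by the levels. *)
Definition try_extend (g h : baire) n (s : seq nat) : seq nat :=
  let t := CodeSeq.decode (nth 0 (CodeSeq.decode (h n)) (CodeSeq.code s)) in
  if prefix s t && (CodeSeq.code t < levels g n.+1)%N then t else s.

Fixpoint branch (g h : baire) n : seq nat :=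
  if n is m.+1 then try_extend g h m (branch g h m) else [::].

Lemma branch_prefix g h n : prefix (branch g h n) (branch g h n.+1).
Proof.
by rewrite /= /try_extend; case: ifP => [/andP[]//|_]; rewrite prefix_refl.
Qed.

Lemma branch_level g h n : (CodeSeq.code (branch g h n) < levels g n)%N.
Proof.
elim: n => [|n IH] /=; first by rewrite (leq_ltn_trans _ (levels_gt g 0)).
rewrite /try_extend; case: ifP => [/andP[]//|_].
exact: ltn_trans IH (levels_ltS g n).
Qed.

Definition guess (g h : baire) : baire := branch_limit (branch g h).

(** The Fubini-type property behind both inequalities. Here [F m] bounds [m] and
    all codes of [phi s] for sequences [s] of code below [m]; [X] is the set of
    [n] such that the next level is at least [F] of the [n]-th one; [y n] is the
    table of [phi] below the [n]-th level. Whenever [n] is in [X] and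
    [h n = y n], the branch takes a step along [phi]. *)
Lemma two_step (M : set baire) : meager M ->
  exists2 E, meager_minus E &
    forall g, ~ E g -> exists2 E', meager_minus E' &
      forall h, ~ E' h -> ~ M (guess g h).
Proof.
move=> /meager_extension[phi [phiP phiM]].
pose f c := CodeSeq.code (phi (CodeSeq.decode c)).
pose F m := (m + \sum_(i < m) f i).+1.
have Fmono : {homo F : m n / (m <= n)%N}.
  apply: homo_leq => [//|m n p|m]; first exact: leq_trans.
  by rewrite /F big_ord_recr /=; lia.
have Ff i m : (i < m)%N -> (f i < F m)%N.
  by move=> im; rewrite /F (bigD1 (Ordinal im))//=; lia.
exists (missing setT (fun n => iter n.*2 F 0)).
  exact: meager_minus_missingT.
move=> g /not_missing gy.
pose X := [set n | (F (levels g n) <= levels g n.+1)%N].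
have Xinf : frequently X.
  apply: levels_escape => // [m|m]; first by rewrite /F; lia.
  by have [n mn [_ ?]] := gy m; exists n.
pose y : baire := fun n => CodeSeq.code (mkseq f (levels g n)).
exists (missing X y); first exact: meager_minus_missing.
move=> h /not_missing hy; apply: phiM; first exact: branch_prefix.
move=> m; have [n mn [Xn hn]] := hy m; exists n => //=.
rewrite /try_extend hn /y CodeSeq.codeK nth_mkseq ?branch_level//.
rewrite /f !CodeSeq.codeK phiP /=.
suff -> : (CodeSeq.code (phi (branch g h n)) < levels g n.+1)%N by [].
apply: leq_trans Xn.
by have := Ff _ _ (branch_level g h n); rewrite /f CodeSeq.codeK.
Qed.

(** * The cardinal invariants *)

(** A finite set is missed everywhere by a function exceeding the sum of its
    elements. *)
Lemma non_meager_minus_infinite (A : set baire) :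
  ~ meager_minus A -> infinite_set A.
Proof.
move=> nA finA; apply: nA.
have [s ->] := (finite_seqP A).1 finA.
have [xF [I part sub]] :=
  meager_minus_missingT (fun n => (\sum_(x <- s) (x : baire) n).+1).
exists xF, I => // x xs; apply: sub; exists 0 => // n _ _ xn.
have : (x n <= \sum_(x <- s) (x : baire) n)%N.
  by rewrite (big_rem x)//= leq_addr.
by rewrite xn ltnn.
Qed.

(** Two covers indexed by [C] are tried: the sets [E M] excluding bad first
    guesses, and, if some [g] escapes all of them, the sets [E' M] excluding bad
    second guesses after this [g]. A point [h] outside all [E' M] would put
    [guess g h] outside every [M] in [C]. *)
Lemma cov_meager_minus_le (C : set (set baire)) :
  C `<=` @meager baire -> \bigcup_(F in C) F = setT ->
  exists D, [/\ D `<=` meager_minus, \bigcup_(F in D) F = setT & D #<= C].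
Proof.
move=> CM Ccov.
have image_cover (E : set baire -> set baire) :
    (forall M, C M -> meager_minus (E M)) ->
    (forall g, exists2 M, C M & E M g) ->
  exists D, [/\ D `<=` meager_minus, \bigcup_(F in D) F = setT & D #<= C].
  move=> Emm Ecov; exists (E @` C); split; last exact: card_image_le.
    by move=> _ [M CM' <-]; exact: Emm.
  apply/seteqP; split=> // g _; have [M CM' Mg] := Ecov g.
  by exists (E M) => //; exists M.
have /choice[E EP] M : exists E, C M -> meager_minus E /\
    forall g, ~ E g -> exists2 E', meager_minus E' &
      forall h, ~ E' h -> ~ M (guess g h).
  have [/CM/two_step[E]|nCM] := pselect (C M); first by exists E.
  by exists set0.
have [Ecov|nE] := pselect (forall g, exists2 M, C M & E M g).
  by apply: (image_cover E) => // M /EP[].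
have [g nEg] : exists g, forall M, C M -> ~ E M g.
  apply: contrapT => ng; apply: nE => g; apply: contrapT => nM; apply: ng.
  by exists g => M CM' EMg; apply: nM; exists M.
have /choice[E' E'P] M : exists E', C M -> meager_minus E' /\
      forall h, ~ E' h -> ~ M (guess g h).
  have [CM'|nCM] := pselect (C M); last by exists set0.
  by have [_ /(_ g (nEg M CM'))[E' ? ?]] := EP M CM'; exists E'.
apply: (image_cover E') => [M /E'P[]//|h].
have : (\bigcup_(F in C) F) (guess g h) by rewrite Ccov.
move=> [M CM' Mgh]; exists M => //; apply: contrapT => nE'.
by have [_ /(_ h nE')] := E'P M CM'.
Qed.

(** If [guess] mapped [A `*` A] into a meager set, then since [A] is not in
    [meager_minus] it would contain a good first guess [g] and, after it, a good
    second guess [h], so that [guess g h] would lie outside the meager set. *)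
Lemma non_meager_le (A : set baire) : ~ meager_minus A ->
  exists2 B, ~ @meager baire B & B #<= A.
Proof.
move=> nA; exists ((fun p => guess p.1 p.2) @` (A `*` A)); last first.
  apply: (card_le_trans (card_image_le _ _)).
  exact: (@card_square_le baire) (non_meager_minus_infinite nA).
move=> /two_step[E Emm EP].
have notsub (E' : set baire) : meager_minus E' -> exists2 g, A g & ~ E' g.
  move=> [xF [I part sub]]; apply: contrapT => nE; apply: nA.
  exists xF, I => // g Ag; apply: sub; apply: contrapT => nE'g.
  by apply: nE; exists g.
have [g Ag nEg] := notsub _ Emm; have [E' E'mm E'P] := EP g nEg.
by have [h Ah /E'P] := notsub _ E'mm; apply; exists (g, h).
Qed.

Theorem corollary21 :
  (exists K : set (set baire),
     is_cov meager_minus K /\ is_cov (@meager baire) K) /\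
  (exists K : set baire,
     is_non meager_minus K /\ is_non (@meager baire) K).
Proof.
split.
- have [|K [Kmm Kcov] Kmin] := @min_card_exists (set baire)
    [set A | A `<=` meager_minus /\ \bigcup_(F in A) F = setT].
    exists (range (missing setT)); split.
      by move=> _ [y _ <-]; exact: meager_minus_missingT.
    apply/seteqP; split=> // x _.
    exists (missing setT (fun n => (x n).+1)).
      by exists (fun n => (x n).+1).
    by exists 0 => // n _ _ /n_Sn.
  exists K; split; split=> //; first by exists K.
    exists K => //; split=> // F /Kmm; exact: meager_minus_meager.
  move=> A [AM Acov]; have [D [Dmm Dcov DA]] := cov_meager_minus_le AM Acov.
  exact: card_le_trans (Kmin _ (conj Dmm Dcov)) DA.
- have [|K KM Kmin] := @min_card_exists baire [set A | ~ @meager baire A].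
    have nT : ~ meager_minus setT.
      move=> [xF [I _ /(_ xF Logic.I)[n _ /(_ n (leqnn n))]]].
      by apply.
    by have [B nB _] := non_meager_le nT; exists B.
  exists K; split; split=> //; try by exists K.
    by exists K => //= /meager_minus_meager.
  move=> A /non_meager_le[B nB BA]; exact: card_le_trans (Kmin _ nB) BA.
Qed.
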